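(* Let $T$ be an invertible $n\times n$ real Toeplitz matrix and let $\mathbf{u}=(u_1,\ldots,u_{n+1})^T\in\mathbb{R}^{n+1}$ be a vector with $u_1\neq 0$ and $u_{n+1}\neq 0$. Let $C_t,C_b,C_l,C_r$ be the companion matrices of $\mathbf{u}$. Then the following three statements are equivalent. 1. $\mathbf{u}\in\operatorname{Ker}(\partial T)$. 2. Both $C_tT$ and $TC_r$ are Toeplitz matrices and $C_tT=TC_r$. 3. Both $C_bT$ and $TC_l$ are Toeplitz matrices and $C_bT=TC_l$. Furthermore, when these equivalent conditions hold, $T^{-1}C_t^kT=C_r^k$ for all integers $k$.
   Context: For $\mathbf{u}=(u_1,\ldots,u_{n+1})^T\in\mathbb{R}^{n+1}$ with $u_1,u_{n+1}\neq 0$, the companion matrices of $\mathbf{u}$ are the following $n\times n$ matrices (all nonsingular). $C_t$: first row $\left(-\frac{u_n}{u_{n+1}},-\frac{u_{n-1}}{u_{n+1}},\ldots,-\frac{u_1}{u_{n+1}}\right)$; rows $2,\ldots,n$ are $[\,I_{n-1}\;\;0\,]$. $C_b$: rows $1,\ldots,n-1$ are $[\,0\;\;I_{n-1}\,]$; last row $\left(-\frac{u_{n+1}}{u_1},-\frac{u_n}{u_1},\ldots,-\frac{u_2}{u_1}\right)$. $C_l$: first column $\left(-\frac{u_2}{u_1},-\frac{u_3}{u_1},\ldots,-\frac{u_{n+1}}{u_1}\right)^T$; columns $2,\ldots,n$ are $\begin{bmatrix} I_{n-1}\\ 0\end{bmatrix}$. $C_r$: columns $1,\ldots,n-1$ are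 $\begin{bmatrix}0\\ I_{n-1}\end{bmatrix}$; last column $\left(-\frac{u_1}{u_{n+1}},-\frac{u_2}{u_{n+1}},\ldots,-\frac{u_n}{u_{n+1}}\right)^T$. For an $n\times n$ Toeplitz matrix $T=(a_{i-j})_{i,j=1}^n$, $\partial T$ is the $(n-1)\times(n+1)$ Toeplitz matrix with entries $(\partial T)_{ij}=a_{i-j+1}$, $1\le i\le n-1$, $1\le j\le n+1$; that is, one column is added on the right of $T$ preserving the Toeplitz structure and then the first row is deleted: $$\partial T=\begin{bmatrix} a_1&a_0&a_{-1}&\cdots&a_{1-n}\\ \vdots&\ddots&\ddots&\ddots&\vdots\\ a_{n-1}&\cdots&a_1&a_0&a_{-1}\end{bmatrix}.$$ *)

(* Defs.v *)
From HB Require Import structures.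
From mathcomp Require Import all_boot all_order all_algebra.
From mathcomp Require Import reals.
From mathcomp Require Import zify.

Set Implicit Arguments.
Unset Strict Implicit.
Unset Printing Implicit Defensive.

Import Order.TTheory GRing.Theory Num.Theory.

Local Open Scope ring_scope.

(* Matrix and vector indices start at 0; this does not affect i - j. *)
Definition toeplitz_mx (R : Type) (m n : nat) (a : int -> R) : 'M[R]_(m, n) :=
  \matrix_(i < m, j < n) a (i%:Z - j%:Z).

Definition is_toeplitz (R : Type) (m n : nat) (A : 'M[R]_(m, n)) : Prop :=
  exists a : int -> R, A = toeplitz_mx m n a.

(* The entry a_d of T = (a_(i-j)), read off the first column (d >= 0) or the
   first row (d < 0); only meaningful for `|d| <= n. *)
Definition toeplitz_coef (R : Type) (n : nat) (T : 'M[R]_n.+1) (d : int) : R :=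
  match d with
  | Posz k => T (inord k) ord0
  | Negz k => T ord0 (inord k.+1)
  end.

Definition toeplitz_partial (R : Type) (n : nat) (T : 'M[R]_n.+1) :
    'M[R]_(n, n.+2) :=
  \matrix_(i < n, j < n.+2) toeplitz_coef T (i%:Z - j%:Z + 1).

Lemma toeplitz_coefE (R : Type) (n : nat) (a : int -> R) (d : int) :
  (`|d| <= n)%N -> toeplitz_coef (toeplitz_mx n.+1 n.+1 a) d = a d.
Proof.
case: d => k /= hk; rewrite /toeplitz_coef mxE inordK ?subr0 //.
by rewrite sub0r NegzE.
Qed.

Lemma toeplitz_partialE (R : Type) (n : nat) (a : int -> R)
    (i : 'I_n) (j : 'I_n.+2) :
  toeplitz_partial (toeplitz_mx n.+1 n.+1 a) i j = a (i%:Z - j%:Z + 1).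
Proof.
rewrite mxE toeplitz_coefE //.
have := ltn_ord i; have := ltn_ord j; lia.
Qed.

(* The four companion matrices of u = (u_1, ..., u_(n+2)), of order n+1; the
   coordinate u_(k+1) is u (inord k) 0. *)
Section Companion.
Variables (R : fieldType) (n : nat) (u : 'cV[R]_n.+2).

Definition companion_t : 'M[R]_n.+1 :=
  \matrix_(i, j) if i == ord0 then - (u (inord (n - j)) 0 / u ord_max 0)
                 else (i == j.+1 :> nat)%:R.

Definition companion_b : 'M[R]_n.+1 :=
  \matrix_(i, j) if i == ord_max then - (u (inord (n.+1 - j)) 0 / u ord0 0)
                 else (j == i.+1 :> nat)%:R.

Definition companion_l : 'M[R]_n.+1 :=
  \matrix_(i, j) if j == ord0 then - (u (inord i.+1) 0 / u ord0 0)
                 else (j == i.+1 :> nat)%:R.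

Definition companion_r : 'M[R]_n.+1 :=
  \matrix_(i, j) if j == ord_max then - (u (inord i) 0 / u ord_max 0)
                 else (i == j.+1 :> nat)%:R.

End Companion.

(* Main.v *)
Require Import Defs.
From HB Require Import structures.
From mathcomp Require Import all_boot all_order all_algebra.
From mathcomp Require Import reals.
From mathcomp Require Import zify ring.

(** Write T = (a_(i-j)).  The idea is that u in the kernel of the Toeplitz
    matrix [toeplitz_partial T] says exactly that the finite sequence a
    satisfies the linear recurrence with coefficients u, at every position
    where all the terms of the recurrence are diagonals of T
    ([toeplitz_partial_ker]).  As the two extreme coefficients of u are nonzero,
    the recurrence can be solved for one further diagonal on each side, so the
    kernel condition amounts to T having a generating sequence that satisfies
    the recurrence at two more positions ([toeplitz_recurrent_ext]).

    Multiplying T on the right by [companion_r u] shifts the columns of T to the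
    left and computes the new last column from the recurrence; for a recurrent
    sequence this new column is the next one of the Toeplitz pattern, and
    T C_r = (a_(i-j-1)).  Likewise [companion_l u] shifts to the right, giving
    T C_l = (a_(i-j+1)).

    The left multiplications come for free from the reflection across the
    antidiagonal.  It reverses products, fixes every Toeplitz matrix, and
    exchanges C_t with C_r and C_b with C_l.  Hence C_t T is the reflection of
    T C_r, and is equal to it as soon as T C_r is Toeplitz.  Conversely, the
    equality of C_t T and T C_r in the last column (respectively of C_b T and
    T C_l in the first one) is the recurrence again, one position per row.

    Finally C_t T = T C_r says that C_r is the conjugate of C_t by T, and
    conjugation commutes with integer powers. *)

Set Implicit Arguments.
Unset Strict Implicit.
Unset Printing Implicit Defensive.

Import Order.TTheory GRing.Theory Num.Theory.

Local Open Scope ring_scope.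

(** * Reflection across the antidiagonal *)

Section Antitranspose.
Variables (R : comNzRingType) (n : nat).
Implicit Types A B : 'M[R]_n.

Definition antitrmx A : 'M[R]_n := \matrix_(i, j) A (rev_ord j) (rev_ord i).

Lemma antitrmxM A B : antitrmx (A *m B) = antitrmx B *m antitrmx A.
Proof.
apply/matrixP => i j; rewrite !mxE (reindex_inj rev_ord_inj) /=.
by apply: eq_bigr => k _; rewrite !mxE mulrC.
Qed.

(** The reflection sends position (i, j) to (n-1-j, n-1-i), which lies on the
    same diagonal. *)
Lemma antitrmx_toeplitz (a : int -> R) :
  antitrmx (toeplitz_mx n n a) = toeplitz_mx n n a.
Proof.
apply/matrixP => i j; rewrite !mxE /=; congr a.
by have := ltn_ord i; have := ltn_ord j; lia.
Qed.

End Antitranspose.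

Lemma antitrmx_companion_r (R : fieldType) (n : nat) (u : 'cV[R]_n.+2) :
  antitrmx (companion_r u) = companion_t u.
Proof.
apply/matrixP => i j; rewrite !mxE -!val_eqE /=.
have := ltn_ord i; have := ltn_ord j => hj hi.
have -> : (n.+1 - i.+1 == n)%N = (i == 0 :> nat) by apply/eqP/eqP; lia.
case: eqP => hi0; first by rewrite subSS.
by congr (nat_of_bool _)%:R; apply/eqP/eqP; lia.
Qed.

Lemma antitrmx_companion_l (R : fieldType) (n : nat) (u : 'cV[R]_n.+2) :
  antitrmx (companion_l u) = companion_b u.
Proof.
apply/matrixP => i j; rewrite !mxE -!val_eqE /=.
have := ltn_ord i; have := ltn_ord j => hj hi.
have -> : (n.+1 - i.+1 == 0)%N = (i == n :> nat) by apply/eqP/eqP; lia.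
case: eqP => hi0; first by congr (- (u (inord _) 0 / _)); lia.
by congr (nat_of_bool _)%:R; apply/eqP/eqP; lia.
Qed.

(** * The linear recurrence attached to u *)

Section Recurrence.
Variables (R : fieldType) (n : nat) (u : 'cV[R]_n.+2).
Implicit Types (a : int -> R) (m : nat) (A : 'M[R]_n.+1).

Definition recurrence a m : R := \sum_(k < n.+2) a (m%:Z - k%:Z) * u k 0.

Lemma recurrence_recr a m :
  recurrence a m = \sum_(k < n.+1) a (m%:Z - k%:Z) * u (inord k) 0
                   + a (m%:Z - n.+1%:Z) * u ord_max 0.
Proof.
rewrite /recurrence big_ord_recr /=; congr (_ + _).
apply: eq_bigr => k _; congr (_ * u _ _).
by apply: val_inj; rewrite /= inordK // ltnW // ltnS.
Qed.

Lemma recurrence_recl a m :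
  recurrence a m.+1 = a m.+1%:Z * u ord0 0
                    + \sum_(k < n.+1) a (m%:Z - k%:Z) * u (inord k.+1) 0.
Proof.
rewrite /recurrence big_ord_recl /= subr0; congr (_ + _).
apply: eq_bigr => k _; congr (a _ * u _ _).
  by rewrite /bump /=; lia.
by apply: val_inj; rewrite /= inordK // ltnS ltn_ord.
Qed.

Lemma toeplitz_partial_ker a :
  toeplitz_partial (toeplitz_mx n.+1 n.+1 a) *m u = 0
  <-> forall i, (i < n)%N -> recurrence a i.+1 = 0.
Proof.
have mulE (i : 'I_n) :
    (toeplitz_partial (toeplitz_mx n.+1 n.+1 a) *m u) i 0 = recurrence a i.+1.
  rewrite mxE; apply: eq_bigr => k _; rewrite toeplitz_partialE.
  by congr (a _ * _); lia.
split=> [ker i lt_in | rec].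
  by have := mulE (Ordinal lt_in); rewrite ker mxE.
by apply/colP => i; rewrite mulE rec // mxE.
Qed.

Lemma mulmx_companion_r A i j :
  (A *m companion_r u) i j =
    if j == ord_max
    then - ((\sum_(k < n.+1) A i k * u (inord k) 0) / u ord_max 0)
    else A i (inord j.+1).
Proof.
rewrite mxE; case: ifP => [/eqP -> | j_max].
  rewrite mulr_suml -sumrN; apply: eq_bigr => k _.
  by rewrite mxE eqxx mulrN mulrA.
have lt_jn : (j.+1 < n.+1)%N.
  by move: j_max (ltn_ord j); rewrite -val_eqE /=; lia.
rewrite (bigD1 (inord j.+1)) //= big1 => [|k].
  by rewrite mxE j_max inordK // eqxx mulr1 addr0.
by rewrite mxE j_max -val_eqE /= inordK // => /negbTE ->; rewrite mulr0.
Qed.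

Lemma mulmx_companion_l A i j :
  (A *m companion_l u) i j =
    if j == ord0
    then - ((\sum_(k < n.+1) A i k * u (inord k.+1) 0) / u ord0 0)
    else A i (inord j.-1).
Proof.
rewrite mxE; case: ifP => [/eqP -> | j0].
  rewrite mulr_suml -sumrN; apply: eq_bigr => k _.
  by rewrite mxE eqxx mulrN mulrA.
have j_gt0 : (0 < j)%N by move: j0; rewrite -val_eqE /=; lia.
have lt_jn : (j.-1 < n.+1)%N by have := ltn_ord j; lia.
rewrite (bigD1 (inord j.-1)) //= big1 => [|k].
  by rewrite mxE j0 inordK // prednK // eqxx mulr1 addr0.
rewrite mxE j0 -val_eqE /= inordK // => k_neq.
by case: eqP => [jk|]; [move: k_neq; rewrite jk eqxx | rewrite mulr0].
Qed.

Lemma companion_t_mul_antitr A :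
  companion_t u *m antitrmx A = antitrmx (A *m companion_r u).
Proof. by rewrite antitrmxM antitrmx_companion_r. Qed.

Lemma companion_b_mul_antitr A :
  companion_b u *m antitrmx A = antitrmx (A *m companion_l u).
Proof. by rewrite antitrmxM antitrmx_companion_l. Qed.

(** Entry (i, n) of the product is the value of the recurrence at i solved for
    its last term a_(i-n-1). *)
Lemma toeplitz_mul_companion_r a (u_last : u ord_max 0 != 0) i :
  (toeplitz_mx n.+1 n.+1 a *m companion_r u) i ord_max
    = a (i%:Z - n.+1%:Z) - recurrence a i / u ord_max 0.
Proof.
rewrite mulmx_companion_r eqxx recurrence_recr.
under eq_bigr => k _ do rewrite mxE.
by field.
Qed.

(** Entry (i, 0) of the product is the value of the recurrence at i+1 solved
    for its first term a_(i+1). *)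
Lemma toeplitz_mul_companion_l a (u_first : u ord0 0 != 0) (i : 'I_n.+1) :
  (toeplitz_mx n.+1 n.+1 a *m companion_l u) i ord0
    = a i.+1%:Z - recurrence a i.+1 / u ord0 0.
Proof.
rewrite mulmx_companion_l eqxx recurrence_recl.
under eq_bigr => k _ do rewrite mxE.
by field.
Qed.

Lemma toeplitz_shift_r a (u_last : u ord_max 0 != 0) :
    (forall m, (m <= n)%N -> recurrence a m = 0) ->
  toeplitz_mx n.+1 n.+1 a *m companion_r u
    = toeplitz_mx n.+1 n.+1 (fun d => a (d - 1)).
Proof.
move=> rec; apply/matrixP => i j; rewrite [RHS]mxE.
have [-> | j_max] := eqVneq j ord_max.
  rewrite toeplitz_mul_companion_r // rec; last by rewrite -ltnS.
  rewrite mul0r subr0; congr a.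
  by rewrite /=; lia.
rewrite mulmx_companion_r (negbTE j_max) mxE inordK; first by congr a; lia.
by move: j_max (ltn_ord j); rewrite -val_eqE /=; lia.
Qed.

Lemma toeplitz_shift_l a (u_first : u ord0 0 != 0) :
    (forall m, (m <= n)%N -> recurrence a m.+1 = 0) ->
  toeplitz_mx n.+1 n.+1 a *m companion_l u
    = toeplitz_mx n.+1 n.+1 (fun d => a (d + 1)).
Proof.
move=> rec; apply/matrixP => i j; rewrite [RHS]mxE.
have [-> | j0] := eqVneq j ord0.
  rewrite toeplitz_mul_companion_l // rec; last by rewrite -ltnS.
  rewrite mul0r subr0; congr a.
  by rewrite /=; lia.
move: j0 (ltn_ord j); rewrite mulmx_companion_l -val_eqE /= => j0 lt_jn.
by rewrite (negbTE j0) mxE inordK; [congr a|]; lia.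
Qed.

(** The diagonals -n-1 and n+1 lie outside T.  The first occurs in the
    recurrence at positions 0, ..., n+1 only at 0, with coefficient u_(n+2), and
    the second only at n+1, with coefficient u_1: both can be chosen freely and
    independently to make the recurrence hold there. *)
Lemma toeplitz_recurrent_ext a
    (u_first : u ord0 0 != 0) (u_last : u ord_max 0 != 0) :
    (forall i, (i < n)%N -> recurrence a i.+1 = 0) ->
  exists b, toeplitz_mx n.+1 n.+1 a = toeplitz_mx n.+1 n.+1 b /\
            forall m, (m <= n.+1)%N -> recurrence b m = 0.
Proof.
move=> rec.
pose lo : R := - ((\sum_(k < n.+1) a (0%:Z - k%:Z) * u (inord k) 0)
                  / u ord_max 0).
pose hi : R := - ((\sum_(k < n.+1) a (n%:Z - k%:Z) * u (inord k.+1) 0)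
                  / u ord0 0).
pose b (d : int) :=
  if d == - n.+1%:Z then lo else if d == n.+1%:Z then hi else a d.
have bE d : (`|d| <= n)%N -> b d = a d.
  by move=> le_dn; rewrite /b; do 2![case: eqP => [?|_]; first lia].
have b_lo : b (- n.+1%:Z) = lo by rewrite /b eqxx.
have b_hi : b n.+1%:Z = hi.
  by rewrite /b eqxx; case: eqP => // ?; lia.
exists b; split.
  apply/matrixP => i j; rewrite !mxE bE //.
  by have := ltn_ord i; have := ltn_ord j; lia.
case=> [|m] le_mn.
  rewrite recurrence_recr sub0r b_lo.
  under eq_bigr => k _ do [rewrite bE; last by have := ltn_ord k; lia].
  by rewrite /lo; field.
have [-> | m_neq] := eqVneq m n.
  rewrite recurrence_recl b_hi.
  under eq_bigr => k _ do [rewrite bE; last by have := ltn_ord k; lia].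
  by rewrite /hi; field.
rewrite -(rec m); last lia.
apply: eq_bigr => k _; rewrite bE //.
by have := ltn_ord k; lia.
Qed.

End Recurrence.

(** * Conjugation *)

(** When k is negative and a is not a unit, the two sides still agree by the
    convention a^-1 = a on non-units, as conjugation preserves non-units. *)
Lemma conjr_exprz (R : unitRingType) (x a : R) (k : int) :
  x \is a GRing.unit -> x^-1 * a ^ k * x = (x^-1 * a * x) ^ k.
Proof.
move=> ux.
have conjX (m : nat) : x^-1 * a ^+ m * x = (x^-1 * a * x) ^+ m.
  elim: m => [|m IHm]; first by rewrite !expr0 mulr1 mulVr.
  by rewrite !exprS -IHm -!mulrA mulVKr.
have conjV b : x^-1 * b^-1 * x = (x^-1 * b * x)^-1.
  have [ub | nub] := boolP (b \is a GRing.unit).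
    by rewrite !invrM ?unitrMr ?unitrV // invrK mulrA.
  have nubx : x^-1 * b * x \isn't a GRing.unit.
    by rewrite unitrMl // unitrMr ?unitrV.
  by rewrite (invr_out nub) (invr_out nubx).
by case: k => m; [exact: conjX | rewrite !NegzE -!exprnN conjV conjX].
Qed.

Theorem theorem2p1 (R : realType) (n : nat) (T : 'M[R]_n.+1) (u : 'cV[R]_n.+2)
    (toeplitzT : is_toeplitz T) (unitT : T \in unitmx)
    (u_first : u ord0 0 != 0) (u_last : u ord_max 0 != 0) :
  [<-> toeplitz_partial T *m u = 0;
       [/\ is_toeplitz (companion_t u *m T), is_toeplitz (T *m companion_r u)
         & companion_t u *m T = T *m companion_r u];
       [/\ is_toeplitz (companion_b u *m T), is_toeplitz (T *m companion_l u)
         & companion_b u *m T = T *m companion_l u]]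
  /\ (toeplitz_partial T *m u = 0 ->
      forall k : int, invmx T *m companion_t u ^ k *m T = companion_r u ^ k).
Proof.
case: toeplitzT unitT => a -> unitT.
have eq_r : toeplitz_partial (toeplitz_mx n.+1 n.+1 a) *m u = 0 ->
    exists b, toeplitz_mx n.+1 n.+1 a *m companion_r u = toeplitz_mx n.+1 n.+1 b
      /\ companion_t u *m toeplitz_mx n.+1 n.+1 a = toeplitz_mx n.+1 n.+1 b.
  move=> /toeplitz_partial_ker.
  move=> /(toeplitz_recurrent_ext u_first u_last)[c [-> rec]].
  exists (fun d => c (d - 1)).
  rewrite -{2}antitrmx_toeplitz companion_t_mul_antitr toeplitz_shift_r //.
    by rewrite antitrmx_toeplitz.
  by move=> m le_mn; apply: rec; apply: leqW.
have eq_l : toeplitz_partial (toeplitz_mx n.+1 n.+1 a) *m u = 0 ->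
    exists b, toeplitz_mx n.+1 n.+1 a *m companion_l u = toeplitz_mx n.+1 n.+1 b
      /\ companion_b u *m toeplitz_mx n.+1 n.+1 a = toeplitz_mx n.+1 n.+1 b.
  move=> /toeplitz_partial_ker.
  move=> /(toeplitz_recurrent_ext u_first u_last)[c [-> rec]].
  exists (fun d => c (d + 1)).
  rewrite -{2}antitrmx_toeplitz companion_b_mul_antitr toeplitz_shift_l //.
    by rewrite antitrmx_toeplitz.
  by move=> m le_mn; apply: rec.
have ker_of_r : companion_t u *m toeplitz_mx n.+1 n.+1 a
      = toeplitz_mx n.+1 n.+1 a *m companion_r u ->
    toeplitz_partial (toeplitz_mx n.+1 n.+1 a) *m u = 0.
  rewrite -{1}antitrmx_toeplitz companion_t_mul_antitr => /matrixP eqM.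
  apply/toeplitz_partial_ker => i lt_in.
  (* On the left, entry (i+1, n) is the reflection of entry (0, n-i-1), which
     lies outside the last column of T C_r and is therefore a_(i-n). *)
  have := eqM (inord i.+1) ord_max.
  rewrite toeplitz_mul_companion_r // mxE mulmx_companion_r.
  rewrite -val_eqE /= !inordK ?mxE /=; try lia.
  rewrite inordK ?ifN; try lia.
  have -> : (n.+1 - n.+1)%:Z - (n.+1 - i.+2).+1%:Z = i.+1%:Z - n.+1%:Z by lia.
  move=> /eqP; rewrite -subr_eq0 opprB addrC subrK.
  by rewrite mulf_eq0 invr_eq0 (negbTE u_last) orbF => /eqP.
have ker_of_l : companion_b u *m toeplitz_mx n.+1 n.+1 a
      = toeplitz_mx n.+1 n.+1 a *m companion_l u ->
    toeplitz_partial (toeplitz_mx n.+1 n.+1 a) *m u = 0.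
  rewrite -{1}antitrmx_toeplitz companion_b_mul_antitr => /matrixP eqM.
  apply/toeplitz_partial_ker => i lt_in.
  (* On the left, entry (i, 0) is the reflection of entry (n, n-i), which lies
     outside the first column of T C_l and is therefore a_(i+1). *)
  have := eqM (inord i) ord0.
  rewrite toeplitz_mul_companion_l // mxE mulmx_companion_l.
  rewrite -val_eqE /= !inordK ?mxE /=; try lia.
  rewrite inordK ?ifN; try lia.
  have -> : (n.+1 - 1)%:Z - (n.+1 - i.+1).-1%:Z = i.+1%:Z by lia.
  move=> /eqP; rewrite -subr_eq0 opprB addrC subrK.
  by rewrite mulf_eq0 invr_eq0 (negbTE u_first) orbF => /eqP.
split.
  tfae=> [/eq_r[b [eq1 eq2]] | [_ _ /ker_of_r/eq_l[b [eq1 eq2]]]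
         | [_ _ /ker_of_l]] //.
  - by split; [exists b | exists b | rewrite eq1].
  - by split; [exists b | exists b | rewrite eq1].
move=> /eq_r[b [eq1 eq2]] k.
have <- : (toeplitz_mx n.+1 n.+1 a)^-1 * companion_t u * toeplitz_mx n.+1 n.+1 a
    = companion_r u.
  by rewrite -mulrA [companion_t u * _]eq2 -eq1 [LHS]mulKr.
exact: conjr_exprz.
Qed.
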